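(* For every prime power $q$, the treewidth of the $q$-Kneser graph $\Gamma=K_q(4,2,1)$ equals $|V(\Gamma)|-(q^2+q+2)$.
   Context: $K_q(4,2,1)$ is the graph whose vertices are the $2$-dimensional subspaces of $F_q^4$, two vertices $U_1,U_2$ being adjacent iff $U_1\cap U_2=\{0\}$. Treewidth is the minimum, over tree decompositions $(T,(B_x)_{x\in V(T)})$ (a tree $T$ and vertex sets $B_x$ such that every edge lies in some $B_x$ and for each vertex $v$ the set $\{x:v\in B_x\}$ is nonempty and induces a connected subgraph of $T$), of $\max_x|B_x|-1$. *)

(* Defs.v *)
From HB Require Import structures.
From mathcomp Require Import all_boot all_order all_algebra.

Set Implicit Arguments.
Unset Strict Implicit.
Unset Printing Implicit Defensive.

Import GRing.Theory Num.Theory.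

(* {vspace vT} is a subtype of square matrices, hence finite over a finite
   field; the library stops at the choiceType structure. *)
Section VspaceFinite.
Import VectorInternalTheory.
Variables (F : finFieldType) (vT : vectType F).
HB.instance Definition _ := [Countable of {vspace vT} by <:].
HB.instance Definition _ := [Finite of {vspace vT} by <:].
End VspaceFinite.

Record sgraph := SGraph {
  svertex :> finType;
  sedge : rel svertex;
  sedge_sym : symmetric sedge;
  sedge_irr : irreflexive sedge }.

Definition induces_connected (G : sgraph) (A : {set G}) : Prop :=
  {in A &, forall x y,
    connect [rel a b | [&& a \in A, b \in A & sedge a b]] x y}.

(* A ucycle is a duplicate-free closed walk, so an edge traversed back and
   forth is a ucycle of size 2. *)
Definition acyclic (G : sgraph) : Prop :=
  forall c : seq G, ucycle (@sedge G) c -> size c < 3.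

Definition is_tree (T : sgraph) : Prop :=
  [/\ 0 < #|T|, forall x y : T, connect (@sedge T) x y & acyclic T].

Record tree_decomposition (G : sgraph) := TreeDecomposition {
  td_tree : sgraph;
  td_bag : td_tree -> {set G};
  td_treeP : is_tree td_tree;
  td_edgeP : forall u v : G, sedge u v ->
    exists x, (u \in td_bag x) && (v \in td_bag x);
  td_vertexP : forall v : G, [set x | v \in td_bag x] != set0;
  td_connectedP : forall v : G, induces_connected [set x | v \in td_bag x] }.

(* Integer-valued, so that the width is -1 when all bags are empty. *)
Definition td_width (G : sgraph) (D : tree_decomposition G) : int :=
  ((\max_(x : td_tree D) #|td_bag x|)%N%:Z - 1)%R.

Definition is_treewidth (G : sgraph) (w : int) : Prop :=
  (exists D : tree_decomposition G, td_width D = w) /\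
  (forall D : tree_decomposition G, (w <= td_width D)%R).

Lemma is_treewidth_uniq (G : sgraph) (w1 w2 : int) :
  is_treewidth G w1 -> is_treewidth G w2 -> w1 = w2.
Proof.
move=> [[D1 <-] min1] [[D2 <-] min2].
by apply/eqP; rewrite Order.POrderTheory.eq_le min1 min2.
Qed.

Section QKneser421.
Variable F : finFieldType.

Definition plane := {U : {vspace 'rV[F]_4} | \dim U == 2}.

Definition plane_disjoint : rel plane :=
  [rel U W | (val U :&: val W == 0)%VS].

Lemma plane_disjoint_sym : symmetric plane_disjoint.
Proof. by move=> U W; rewrite /plane_disjoint /= capvC. Qed.

Lemma plane_disjoint_irr : irreflexive plane_disjoint.
Proof.
move=> [U dimU]; rewrite /plane_disjoint /= capvv; apply/negP => /eqP U0.
by move: dimU; rewrite U0 dimv0.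
Qed.

Definition qkneser421 : sgraph := SGraph plane_disjoint_sym plane_disjoint_irr.

End QKneser421.

Definition prime_power (q : nat) : Prop :=
  exists p k : nat, [/\ prime p, 0 < k & q = p ^ k].

(* Main.v *)
Require Import Defs.
From mathcomp Require Import all_boot all_order all_algebra finfield.
From mathcomp Require Import zify ring.

Set Implicit Arguments.
Unset Strict Implicit.
Unset Printing Implicit Defensive.

(* View the vertices as the lines of PG(3,q), adjacent when skew.

   Upper bound: the [q^2+q+1] lines through a point form an independent set
   [I], and every [v] in [I] meets a line outside [I]. Hence a star with
   centre bag [~: I] and leaf bags [v |: N(v)], [v] in [I], is a tree
   decomposition whose bags have at most [#|~: I|] elements.

   Lower bound: write [perp C] for the lines meeting every line of [C], and
   call [C] dominant if [perp C] is smaller than [perp (perp C)] in a fixed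
   total order on sets that refines the comparison of cardinals and extends
   inclusion. Any two dominant sets are joined by an edge, so the connected
   ones form a bramble, and it remains to find one inside every set [A] of
   more than [q^2+q+1] lines. Such an [A] is too large to induce a matching,
   so it contains a path [m1 - m2 - m3]. Let [M = {m1, m2, m3}] and let [C]
   be the component of [A] containing [M]. At most [2q] lines of [perp M] are
   outside [perp (perp M)], so if [C] is not dominant then [C] has at most
   [2q] elements and [A :\: C], which lies in [perp M], has more than [q+1].
   This is impossible when [m1] and [m3] are skew. When they meet, [perp M]
   lies in the union of two pencils that share a line, and any two other
   lines, one of each pencil, are skew; hence [A :\: C] contains a path [T]
   of three lines with [perp T] inside [perp (perp M)]. Then [perp T = perp
   (perp C)] and [perp (perp T) = perp C], so [T] is dominant. *)

(** * Tree decompositions *)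

Lemma exists_neq_in (T : finType) (A : {pred T}) (x : T) :
  1 < #|A| -> exists2 y, y \in A & y != x.
Proof.
case/card_gt1P => y [z [yA zA yz]].
by have [yx|] := eqVneq y x; [exists z; rewrite // eq_sym -yx | exists y].
Qed.

Section InducedSubgraph.
Variable G : sgraph.
Implicit Types (A B : {set G}) (a b s x y : G).

Definition edge_in A a b : bool := [&& a \in A, b \in A & sedge a b].

Lemma connect_edge_in_sym A : connect_sym (edge_in A).
Proof. by apply: sym_connect_sym => a b; rewrite /edge_in sedge_sym andbCA. Qed.

Lemma connect_edge_inS A B :
  A \subset B -> subrel (connect (edge_in A)) (connect (edge_in B)).
Proof.
move=> /subsetP AB; apply: connect_sub => a b /and3P [aA bA eab].
by apply: connect1; rewrite /edge_in !AB.
Qed.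

Lemma induces_connected_hub A s :
  s \in A -> {in A, forall a, a != s -> sedge s a} -> induces_connected A.
Proof.
move=> sA hub x y xA yA.
have from_s a : a \in A -> connect (edge_in A) s a.
  move=> aA; have [-> //|as_neq] := eqVneq a s.
  by apply: connect1; rewrite /edge_in sA aA hub.
by apply: connect_trans (from_s y yA); rewrite connect_edge_in_sym from_s.
Qed.

Definition component A x : {set G} := [set y | connect (edge_in A) x y].

Lemma component_sub A x : x \in A -> component A x \subset A.
Proof.
move=> xA; apply/subsetP => y; rewrite inE connect_edge_in_sym.
by case/connectP => [[|z p]] /= => [_ <- // | /andP [/andP []]].
Qed.

Lemma sub_component A B x :
  x \in B -> B \subset A -> induces_connected B -> B \subset component A x.
Proof.
move=> xB BA conB; apply/subsetP => y yB; rewrite inE.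
exact: connect_edge_inS BA _ _ (conB x y xB yB).
Qed.

Lemma component_edge A x a b :
  a \in component A x -> edge_in A a b -> b \in component A x.
Proof. by rewrite !inE => xa /connect1; apply: connect_trans xa. Qed.

Lemma component_connected A x : induces_connected (component A x).
Proof.
have from_path u p : u \in component A x -> path (edge_in A) u p ->
    connect (edge_in (component A x)) u (last u p).
  elim: p u => //= w p IH u uC /andP [euw pathp].
  have wC := component_edge uC euw.
  apply: connect_trans (IH w wC pathp); apply: connect1.
  by rewrite /edge_in uC wC; case/and3P: euw.
have from_x y : y \in component A x -> connect (edge_in (component A x)) x y.
  rewrite {1}inE => /connectP [p pathp ->]; apply: from_path => //.
  by rewrite inE.
move=> y z /from_x xy /from_x xz; apply: connect_trans xz.
by rewrite connect_edge_in_sym.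
Qed.

End InducedSubgraph.

Section Trees.
Variable T : sgraph.
Implicit Types x y z : T.

Definition edge_except x y a b : bool :=
  sedge a b && ([set a; b] != [set x; y]).

Lemma acyclic_bridge x y :
  acyclic T -> sedge x y -> ~~ connect (edge_except x y) x y.
Proof.
move=> acT exy; apply/negP => /connectP [walk walkP last_walk].
case: (shortenP walkP) last_walk => p pathp uniqp _ lastp.
have := acT (x :: p).
rewrite /ucycle uniqp andbT /= rcons_path -lastp sedge_sym exy andbT.
rewrite (sub_path _ pathp) => [|a b /andP [] //].
case: p pathp lastp {uniqp} => [|a [|b p]] //=.
- by move=> _ yx; move: exy; rewrite yx sedge_irr.
- by rewrite andbT => /andP [_ /eqP neq] ya; case: neq; rewrite ya.
by move=> _ _ /(_ isT).
Qed.

Lemma edge_avoiding_end x y z :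
  z \in [set x; y] -> subrel (edge_in [set~ z]) (edge_except x y).
Proof.
move=> zxy a b; rewrite /edge_in /edge_except !inE => /and3P [za zb ->] /=.
by apply: contraTneq zxy => <-; rewrite !inE negb_or ![z == _]eq_sym za.
Qed.

Lemma acyclic_edge_separates x y z : acyclic T -> sedge x y ->
  connect (edge_in [set~ x]) y z -> ~~ connect (edge_in [set~ y]) x z.
Proof.
move=> acT exy yz; apply: contra (acyclic_bridge acT exy) => xz.
have except_of e u v : subrel e (edge_except x y) -> connect e u v ->
    connect (edge_except x y) u v.
  by move=> sub; apply: connect_sub => a b /sub; apply: connect1.
apply: (@connect_trans _ _ z).
  by apply: except_of xz; apply: edge_avoiding_end; rewrite !inE eqxx orbT.
rewrite connect_edge_in_sym in yz.
by apply: except_of yz; apply: edge_avoiding_end; rewrite !inE eqxx.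
Qed.

Lemma acyclic_reversed_edge (f : T -> T) : acyclic T -> 0 < #|T| ->
  (forall x, sedge x (f x)) -> exists x, f (f x) = x.
Proof.
move=> acT /card_gt0P [x0 _] edge_f.
have /trajectP [i lt_i return_i] := looping_order f x0.
pose x := iter i f x0.
have periodic_x : exists n, iter n.+1 f x = x.
  exists (order f x0 - i).-1; rewrite prednK ?subn_gt0 //.
  by rewrite /x -iterD subnK // ltnW.
have cycle_x : fcycle f (orbit f x) by apply/(@orbitPcycle _ f x 0 3).
have iter_x : iter (order f x) f x = x by apply/(@orbitPcycle _ f x 4 0).
exists x; have : ucycle (@sedge T) (orbit f x).
  rewrite /ucycle orbit_uniq andbT.
  by apply: sub_cycle cycle_x => a b /eqP <-.
move/acT; rewrite size_orbit.
move: iter_x; have := order_gt0 f x; case: (order f x) => [|[|[|n]]] //= _ fx _.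
by have := edge_f x; rewrite fx sedge_irr.
Qed.

Lemma neighbour_towards x z : connect (@sedge T) x z -> x != z ->
  exists2 y, sedge x y & connect (edge_in [set~ x]) y z.
Proof.
move=> /connectP [walk walkP last_walk] xz.
case: (shortenP walkP) last_walk => [[|y p] /=] pathp uniqp _ lastp.
  by rewrite lastp eqxx in xz.
move: pathp uniqp => /andP [exy pathp] /andP [xp _]; exists y => //.
apply/connectP; exists p => //.
elim: p y {exy lastp} pathp xp => //= c p IH y /andP [eyc pathp].
rewrite !inE !negb_or => /and3P [xy xc xp].
by rewrite /edge_in !inE eyc eq_sym xy eq_sym xc /= IH // inE negb_or xc.
Qed.

(* Diagonal form of the Helly property: in a family without a common node, each
   node [x] is missed by some member [Z x].  Send [x] to its neighbour in the
   direction of [Z x]; some edge is then traversed both ways, and it separates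
   the members at its two ends. *)
Lemma tree_helly (Z : T -> {set T}) : is_tree T ->
    (forall x, induces_connected (Z x)) ->
    (forall x y, ~~ [disjoint Z x & Z y]) ->
  exists x, x \in Z x.
Proof.
move=> [T0 conT acT] conZ ZZ.
case: (boolP [exists x, x \in Z x]) => [/existsP //|/existsPn avoid].
have sub_avoid x : Z x \subset [set~ x].
  apply/subsetP => z zZ; rewrite !inE.
  by apply: contraTneq zZ => ->; apply: avoid.
have /fin_all_exists [f fP] x : exists y, sedge x y /\
    {in Z x, forall z, connect (edge_in [set~ x]) y z}.
  have /pred0Pn [z0 /andP [z0Z _]] := ZZ x x.
  have xz0 : x != z0 by apply: contraTneq z0Z => <-; apply: avoid.
  have [y exy yz0] := neighbour_towards (conT x z0) xz0.
  exists y; split=> // z zZ; apply: connect_trans yz0 _.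
  exact: connect_edge_inS (sub_avoid x) _ _ (conZ x z0 z z0Z zZ).
have [x ffx] := acyclic_reversed_edge acT T0 (fun x => (fP x).1).
have /pred0Pn [z /andP [zx zy]] := ZZ x (f x).
have [exy towards_x] := fP x; have [_ towards_y] := fP (f x).
have := acyclic_edge_separates acT exy (towards_x z zx).
by rewrite -{2}ffx towards_y.
Qed.

End Trees.

Section Brambles.
Variable G : sgraph.
Implicit Types (A B C : {set G}) (D : tree_decomposition G).

Definition touching B C : Prop :=
  exists b c, [/\ b \in B, c \in C & sedge b c].

Definition trace D B : {set td_tree D} :=
  [set x | ~~ [disjoint B & td_bag x]].

Lemma traceP D B x :
  reflect (exists2 v, v \in B & v \in td_bag x) (x \in trace D B).
Proof.
rewrite inE; apply: (iffP pred0Pn) => [[v /andP [vB vx]]|[v vB vx]].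
  by exists v.
by exists v; apply/andP.
Qed.

Lemma trace_connected D B :
  induces_connected B -> induces_connected (trace D B).
Proof.
move=> conB x y /traceP [u uB ux] /traceP [v vB vy].
have same_vertex w a b : w \in B -> w \in td_bag a -> w \in td_bag b ->
    connect (edge_in (trace D B)) a b.
  move=> wB wa wb; have := @td_connectedP _ D w a b.
  rewrite !inE => /(_ wa wb); apply: connect_edge_inS.
  by apply/subsetP => c; rewrite inE => wc; apply/traceP; exists w.
have /connectP [p pathp lastp] := conB u v uB vB.
elim: p u x uB ux pathp lastp => [|w p IH] u x uB ux /=.
  by move=> _ vu; apply: (same_vertex v); rewrite // vu.
case/andP => /and3P [_ wB euw] pathp lastp.
have [z /andP [uz wz]] := td_edgeP D euw.
exact: connect_trans (same_vertex u x z uB ux uz) (IH w z wB wz pathp lastp).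
Qed.

Lemma touching_traces D B C :
  touching B C -> ~~ [disjoint trace D B & trace D C].
Proof.
move=> [b [c [bB cC ebc]]]; have [x /andP [bx cx]] := td_edgeP D ebc.
apply/pred0Pn; exists x; apply/andP.
by split; apply/traceP; [exists b | exists c].
Qed.

Lemma bramble_max_bag (P : {set G} -> Prop) (m : nat) :
    (forall C, P C -> induces_connected C) ->
    (forall B C, P B -> P C -> touching B C) ->
    (forall A, m < #|A| -> exists2 C : {set G}, C \subset A & P C) ->
  forall D, #|G| - m <= \max_(x : td_tree D) #|td_bag x|.
Proof.
move=> conP touchP largeP D; rewrite leqNgt; apply/negP => small.
have /fin_all_exists2 [beta sub_beta beta_P] (x : td_tree D) :
    exists2 C : {set G}, C \subset ~: td_bag x & P C.
  apply: largeP; rewrite cardsCs setCK ltn_subRL addnC -ltn_subRL.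
  apply: leq_ltn_trans small.
  exact: (leq_bigmax (F := fun y => #|td_bag y|)).
have [] := @tree_helly _ (fun x => trace D (beta x)) (td_treeP D).
- by move=> x; apply/trace_connected/conP.
- by move=> x y; apply/touching_traces/touchP.
by move=> x; rewrite inE disjoints_subset sub_beta.
Qed.

End Brambles.

Section StarTree.
Variable T : finType.

Definition star_edge : rel (option T) := [rel x y | isSome x != isSome y].

Lemma star_edge_sym : symmetric star_edge.
Proof. by move=> x y; rewrite /star_edge /= eq_sym. Qed.

Lemma star_edge_irr : irreflexive star_edge.
Proof. by move=> x; rewrite /star_edge /= eqxx. Qed.

Definition star : sgraph := SGraph star_edge_sym star_edge_irr.

Lemma star_is_tree : is_tree star.
Proof.
split=> [|x y|].
- by apply/card_gt0P; exists None.
- apply: (@connect_trans _ _ None); case: x y => [x|] [y|] //;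
    by apply: connect1.
case=> [|[x|] [|[y|] [|[z|] [|[w|] s]]]] //.
all: by rewrite /ucycle ?/star_edge /= ?inE ?andbF.
Qed.

End StarTree.

Section StarDecomposition.
Variables (G : sgraph) (I : {set G}).
Hypothesis indepI : {in I &, forall u v, ~~ sedge u v}.

Definition star_bag (x : star G) : {set G} :=
  if x is Some v then if v \in I then v |: [set u | sedge v u] else set0
  else ~: I.

Lemma in_star_bag_centre v : (v \in star_bag None) = (v \notin I).
Proof. by rewrite inE. Qed.

Lemma in_star_bag_leaf u v :
  (v \in star_bag (Some u)) = (u \in I) && ((v == u) || sedge u v).
Proof. by rewrite /=; case: ifP => _; rewrite !inE. Qed.

Lemma star_bag_edge (u v : G) :
  sedge u v -> exists x, (u \in star_bag x) && (v \in star_bag x).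
Proof.
move=> euv; have [uI|uI] := boolP (u \in I).
  by exists (Some u); rewrite !in_star_bag_leaf uI eqxx euv orbT.
have [vI|vI] := boolP (v \in I).
  by exists (Some v); rewrite !in_star_bag_leaf vI eqxx sedge_sym euv orbT.
by exists None; rewrite !in_star_bag_centre uI vI.
Qed.

Lemma star_bag_vertex (v : G) : [set x | v \in star_bag x] != set0.
Proof.
apply/set0Pn; have [vI|vI] := boolP (v \in I).
  by exists (Some v); rewrite inE in_star_bag_leaf vI eqxx.
by exists None; rewrite inE in_star_bag_centre vI.
Qed.

Lemma star_bag_connected (v : G) :
  induces_connected [set x | v \in star_bag x].
Proof.
have [vI|vI] := boolP (v \in I).
  apply: (@induces_connected_hub _ _ (Some v : star G)) => [|[u|]].
  - by rewrite inE in_star_bag_leaf vI eqxx.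
  - rewrite inE in_star_bag_leaf => /andP [uI /orP [/eqP -> /eqP //|euv]].
    by rewrite (negPf (indepI uI vI)) in euv.
  by rewrite inE in_star_bag_centre vI.
apply: (@induces_connected_hub _ _ (None : star G)) => [|[u|]] //.
by rewrite inE in_star_bag_centre.
Qed.

Definition star_decomposition : tree_decomposition G :=
  TreeDecomposition (star_is_tree G) star_bag_edge star_bag_vertex
    star_bag_connected.

Lemma max_star_bag :
    {in I, forall v, exists2 u, u \notin I & ~~ sedge v u} ->
  \max_(x : td_tree star_decomposition) #|td_bag x| <= #|~: I|.
Proof.
move=> non_neighbour; apply/bigmax_leqP => -[v|] _ //=.
case: ifP => [vI|_]; last by rewrite cards0.
have [u uI euv] := non_neighbour v vI.
apply: leq_trans (_ : #|v |: (~: I :\ u)| <= _).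
  apply: subset_leq_card; apply: setUS; apply/subsetP => w.
  rewrite !inE => evw; apply/andP; split; first by apply: contraNneq euv => <-.
  by apply/negP => wI; rewrite (negPf (indepI vI wI)) in evw.
by rewrite cardsU1 (cardsD1 u (~: I)) !inE uI vI /= andbF.
Qed.

End StarDecomposition.

Lemma is_treewidth_max_bag (G : sgraph) (n : nat) (D0 : tree_decomposition G) :
    \max_(x : td_tree D0) #|td_bag x| <= n ->
    (forall D : tree_decomposition G, n <= \max_(x : td_tree D) #|td_bag x|) ->
  is_treewidth G (n%:Z - 1)%R.
Proof.
move=> max_D0 min_n; split=> [|D].
  exists D0; rewrite /td_width; congr (_%:Z - 1)%R.
  by apply/eqP; rewrite eqn_leq max_D0 min_n.
by rewrite Num.Theory.lerD2r lez_nat min_n.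
Qed.

(** * Dominant sets of vertices *)

Section Perp.
Variable G : sgraph.
Implicit Types (A B C : {set G}) (c v : G).

Definition perp C : {set G} := [set v | [forall c in C, ~~ sedge c v]].

Lemma perpP C v : reflect {in C, forall c, ~~ sedge c v} (v \in perp C).
Proof. by rewrite inE; apply: forall_inP. Qed.

Lemma perpS B C : B \subset C -> perp C \subset perp B.
Proof.
move=> /subsetP BC; apply/subsetP => v /perpP vC.
by apply/perpP => c /BC /vC.
Qed.

Lemma sub_perpC B C : (B \subset perp C) = (C \subset perp B).
Proof.
by apply/subsetP/subsetP => sub v hv; apply/perpP => c hc; rewrite sedge_sym;
   move/perpP: (sub _ hc); apply.
Qed.

Lemma sub_perp2 C : C \subset perp (perp C).
Proof. by rewrite -sub_perpC. Qed.

Lemma perp3 C : perp (perp (perp C)) = perp C.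
Proof. by apply/eqP; rewrite eqEsubset sub_perp2 perpS ?sub_perp2. Qed.

Lemma component_perp A v : v \in A ->
  A :\: component A v \subset perp (component A v).
Proof.
move=> vA; apply/subsetP => u /setDP [uA uC]; apply/perpP => c cC.
apply: contra uC => ecu; apply: (component_edge cC).
by rewrite /edge_in uA ecu (subsetP (component_sub vA)).
Qed.

Lemma connected_disjoint_perp C :
  induces_connected C -> 1 < #|C| -> [disjoint C & perp C].
Proof.
move=> conC card_C; rewrite disjoint_subset; apply/subsetP => c cC.
rewrite inE; apply/perpP => perp_c; have [d dC dc] := exists_neq_in c card_C.
have /connectP [[|e p]] := conC c d cC dC.
  by move=> _ /eqP; rewrite (negPf dc).
case/andP => /and3P [_ eC ece] _ _.
by have := perp_c e eC; rewrite sedge_sym ece.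
Qed.

End Perp.

Section InclusionExtension.
Import Order.POrderTheory.
Variable T : finType.
Implicit Types S U : {set T}.

Definition set_key S : nat *l 'I_#|{set T}| := (#|S|, enum_rank S).

Lemma set_key_inj : injective set_key.
Proof. by move=> S U [_ /enum_rank_inj]. Qed.

Lemma leq_card_set_key S U : (set_key S <= set_key U)%O -> #|S| <= #|U|.
Proof. by rewrite leEprodlexi => /andP []. Qed.

Lemma set_keyS S U : S \subset U -> (set_key S <= set_key U)%O.
Proof.
rewrite subEproper => /predU1P [-> // | /proper_card SU].
by rewrite leEprodlexi /= !leEnat ltnW //= leqNgt SU.
Qed.

End InclusionExtension.

Section Dominance.
Import Order.POrderTheory Order.TotalTheory.
Variable G : sgraph.
Implicit Types (A B C M T : {set G}).

Definition dominant C : bool :=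
  (set_key (perp C) < set_key (perp (perp C)))%O.

(* If no edge joined [B] and [C], then [C <= perp B] and [B <= perp C] would
   give the cycle
   [perp B < perp (perp B) <= perp C < perp (perp C) <= perp B]. *)
Lemma dominant_touching B C : dominant B -> dominant C -> touching B C.
Proof.
move=> domB domC; have [|no_edge] := boolP (C \subset perp B); last first.
  have /subsetPn [c cC] := no_edge.
  rewrite inE negb_forall => /existsP [b]; rewrite negb_imply negbK.
  by case/andP => bB ebc; exists b, c.
move=> CB; have BC : B \subset perp C by rewrite sub_perpC.
have: (set_key (perp B) < set_key (perp B))%O; last by rewrite ltxx.
apply: lt_le_trans (lt_le_trans domB (set_keyS (perpS CB))) _.
exact: le_trans (ltW domC) (set_keyS (perpS BC)).
Qed.

Lemma dominant_of_perp2 C T : ~~ dominant C -> C != set0 ->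
    [disjoint C & perp C] -> T \subset perp C ->
    perp T \subset perp (perp C) ->
  dominant T.
Proof.
rewrite /dominant -leNgt => keyC /set0Pn [c cC] disC TC perpTC.
have perpT : perp T = perp (perp C).
  by apply/eqP; rewrite eqEsubset perpTC perpS.
rewrite perpT perp3 lt_neqAle keyC andbT; apply/eqP => /set_key_inj perp2C.
by move: (disjointFr disC cC); rewrite -perp2C (subsetP (sub_perp2 C)).
Qed.

Lemma card_not_dominant C M : ~~ dominant C -> M \subset C ->
    [disjoint C & perp C] ->
  #|C| <= #|perp M :\: perp (perp M)|.
Proof.
rewrite /dominant -leNgt => /leq_card_set_key cardC MC disC.
apply: leq_trans (_ : #|perp (perp C) :\: perp C| <= _).
  by apply: subset_leq_card; rewrite subsetD sub_perp2.
apply: leq_trans (_ : #|perp C :\: perp (perp C)| <= _).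
  by rewrite !cardsD setIC leq_sub2r.
by apply/subset_leq_card/setDSS; rewrite ?perpS.
Qed.

Lemma dominant_connected_subset A M (k n : nat) :
    M \subset A -> induces_connected M -> 1 < #|M| ->
    #|perp M :\: perp (perp M)| <= k ->
    (forall B, B \subset perp M -> n < #|B| ->
       exists T, [/\ T \subset B, induces_connected T &
                     perp T \subset perp (perp M)]) ->
    k + n < #|A| ->
  exists2 C : {set G}, C \subset A & induces_connected C /\ dominant C.
Proof.
move=> MA conM cardM boundM largeM cardA.
have [v vM] : exists v, v \in M by apply/card_gt0P; apply: ltnW.
have vA := subsetP MA v vM; pose C := component A v.
have [CA conC] : C \subset A /\ induces_connected C.
  by split; [exact: component_sub | exact: component_connected].
have MC : M \subset C by apply: sub_component.
have [|not_domC] := boolP (dominant C); first by exists C.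
have disC : [disjoint C & perp C].
  by apply: connected_disjoint_perp conC (leq_trans cardM (subset_leq_card MC)).
have cardC := leq_trans (card_not_dominant not_domC MC disC) boundM.
have restC : A :\: C \subset perp C by apply: component_perp.
have [||T [TB conT perpT]] := largeM (A :\: C).
- exact: subset_trans restC (perpS MC).
- rewrite cardsDS // ltn_subRL; apply: leq_ltn_trans cardA.
  by rewrite leq_add2r.
exists T; first exact: subset_trans TB (subsetDl _ _).
split=> //; apply: (dominant_of_perp2 not_domC) => //.
- by apply/set0Pn; exists v; apply: (subsetP MC).
- exact: subset_trans TB restC.
by apply: subset_trans perpT _; rewrite !perpS.
Qed.

End Dominance.

(** * Points, lines and planes of a projective space *)

Section Incidence.
Variables (F : fieldType) (vT : vectType F).
Implicit Types (U W a b m p r t x : {vspace vT}).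
Local Open Scope vspace_scope.

Lemma dimv_gt0 U : (0 < \dim U)%N = (U != 0).
Proof. by rewrite lt0n dimv_eq0. Qed.

Definition meets U W : bool := U :&: W != 0.

Lemma meetsC U W : meets U W = meets W U.
Proof. by rewrite /meets capvC. Qed.

Lemma meetsPn {U W} : reflect (U :&: W = 0) (~~ meets U W).
Proof. by rewrite negbK; apply: eqP. Qed.

Lemma meetsS U U' W W' : U <= U' -> W <= W' -> meets U W -> meets U' W'.
Proof.
move=> UU' WW'; rewrite /meets -!dimv_gt0 => /leq_trans; apply.
by apply/dimvS/capvS.
Qed.

Lemma meets_common p U W : p != 0 -> p <= U -> p <= W -> meets U W.
Proof. by move=> p0 pU pW; apply: (meetsS pU pW); rewrite /meets capvv. Qed.

Lemma meets_of_dim U W (V : {vspace vT}) :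
  U <= V -> W <= V -> (\dim V < \dim U + \dim W)%N -> meets U W.
Proof.
move=> UV WV dim_lt; rewrite /meets -dimv_gt0; have := dimv_sum_cap U W.
by have : (\dim (U + W) <= \dim V)%N; [apply: dimvS; rewrite subv_add UV | lia].
Qed.

Lemma capv_hyperplane p t U : \dim t = (\dim p).+1 -> p <= t -> p <= U ->
  ~~ (t <= U) -> t :&: U = p.
Proof.
move=> dim_t pt pU tU; apply/esym/eqP.
rewrite eqEdim subv_cap pt pU /= -ltnS -dim_t.
by rewrite (ltn_leqif (dimv_leqif_sup (capvSl t U))) subv_cap subvv.
Qed.

Lemma meets_point p U : \dim p = 1%N -> meets p U = (p <= U).
Proof.
move=> dim_p; rewrite /meets -dimv_gt0.
rewrite (sameP (@capv_idPl _ _ p U) eqP).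
by rewrite eqEdim capvSl dim_p.
Qed.

Lemma dim_meeting_lines r t : \dim r = 2 -> \dim t = 2 -> r != t ->
  meets r t -> \dim (r :&: t) = 1%N /\ \dim (r + t) = 3.
Proof.
move=> dim_r dim_t rt; rewrite /meets -dimv_gt0 => dim_cap.
have := dimv_sum_cap r t.
suff : (\dim (r :&: t) < 2)%N by lia.
rewrite ltnNge; apply: contra rt => cap2.
have cap_r : r :&: t == r by rewrite eqEdim capvSl dim_r.
have cap_t : r :&: t == t by rewrite eqEdim capvSr dim_t.
by rewrite -(eqP cap_r) (eqP cap_t).
Qed.

Lemma add_points p p' t : \dim t = 2 -> \dim p = 1%N -> \dim p' = 1%N ->
  p <= t -> p' <= t -> p != p' -> p + p' = t.
Proof.
move=> dim_t dim_p dim_p' pt p't pp'.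
have cap0 : p :&: p' = 0.
  apply/meetsPn; rewrite meets_point //; apply: contra pp' => sub.
  by rewrite eqEdim sub dim_p dim_p'.
apply/eqP; rewrite eqEdim subv_add pt p't dimv_disjoint_sum //.
by rewrite dim_t dim_p dim_p'.
Qed.

Lemma add_caps a b t : \dim t = 2 -> meets t a -> meets t b ->
    ~~ meets t (a :&: b) ->
  [/\ \dim (t :&: a) = 1%N, \dim (t :&: b) = 1%N & t :&: a + t :&: b = t].
Proof.
move=> dim_t + + /meetsPn tab; rewrite /meets -!dimv_gt0 => ta tb.
have dim_add : \dim (t :&: a + t :&: b) = (\dim (t :&: a) + \dim (t :&: b))%N.
  apply: dimv_disjoint_sum; apply/eqP; rewrite -subv0 -tab !subv_cap.
  rewrite (subv_trans (capvSl _ _) (capvSl _ _)).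
  rewrite (subv_trans (capvSl _ _) (capvSr _ _)).
  by rewrite (subv_trans (capvSr _ _) (capvSr _ _)).
have sub : t :&: a + t :&: b <= t by rewrite subv_add !capvSl.
have := dimvS sub; rewrite dim_add dim_t => dim_le.
by split; [lia | lia | apply/eqP; rewrite eqEdim sub dim_add dim_t; lia].
Qed.

Lemma line_sub_add a b t : \dim t = 2 -> meets t a -> meets t b ->
  ~~ meets t (a :&: b) -> t <= a + b.
Proof.
move=> dim_t ta tb tab; have [_ _ <-] := add_caps dim_t ta tb tab.
by apply: addvS; apply: capvSr.
Qed.

Lemma concurrent_or_coplanar a b t : \dim t = 2 -> \dim (a :&: b) = 1%N ->
  meets t a -> meets t b -> (a :&: b <= t) || (t <= a + b).
Proof.
move=> dim_t dim_cap ta tb; rewrite -meets_point // meetsC.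
by case: (boolP (meets t _)) => //= tab; apply: line_sub_add.
Qed.

Lemma coplanar_triangle a b c t : \dim (a :&: b) = 1%N ->
    \dim c = 2 -> ~~ (a :&: b <= c) -> meets c a -> meets c b ->
    \dim t = 2 -> meets t a -> meets t b -> meets t c ->
  t <= a + b.
Proof.
set p := a :&: b => dim_p dim_c pc ca cb dim_t ta tb tc.
have /orP [pt|//] := concurrent_or_coplanar dim_t dim_p ta tb.
have cU : c <= a + b.
  by have := concurrent_or_coplanar dim_c dim_p ca cb; rewrite (negPf pc).
have pU : p <= a + b := subv_trans (capvSl _ _) (addvSl _ _).
apply: contraLR tc => tU; rewrite /meets -(capv_idPr cU) capvA.
have -> : t :&: (a + b) = p by apply: capv_hyperplane; rewrite // dim_t dim_p.
by rewrite -/(meets p c) meets_point.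
Qed.

(* In projective terms: the points of [U] when [p = 0], and the lines of [U]
   through [p] when [p] is a point. *)
Definition pencil p U : pred {vspace vT} :=
  [pred t : {vspace vT} | [&& \dim t == (\dim p).+1, p <= t & t <= U]].

Lemma pencilP p U t :
  reflect [/\ \dim t = (\dim p).+1, p <= t & t <= U] (t \in pencil p U).
Proof. by apply: (iffP and3P) => -[/eqP]. Qed.

Lemma pencil_cap p U r t :
  r \in pencil p U -> t \in pencil p U -> r != t -> r :&: t = p.
Proof.
move=> /pencilP [dim_r pr _] /pencilP [dim_t pt _] rt.
apply: capv_hyperplane => //; apply: contra rt => sub.
by rewrite eqEdim sub dim_r dim_t leqnn.
Qed.

Lemma pencil_add p U r t : \dim U = (\dim p).+2 ->
  r \in pencil p U -> t \in pencil p U -> r != t -> r + t = U.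
Proof.
move=> dim_U rP tP rt; have cap_rt := pencil_cap rP tP rt.
move: rP tP => /pencilP [dim_r _ rU] /pencilP [dim_t _ tU].
apply/eqP; rewrite eqEdim subv_add rU tU.
by have := dimv_sum_cap r t; rewrite cap_rt; lia.
Qed.

Lemma pencil_meets p U x r r' t : \dim p = 1%N -> \dim U = 3 -> \dim x = 2 ->
    r \in pencil p U -> r' \in pencil p U -> r != r' ->
    meets x r -> meets x r' ->
  t \in pencil p U -> meets x t.
Proof.
move=> dim_p dim_U dim_x rP r'P rr' xr xr' /pencilP [dim_t pt tU].
have dim_Up : \dim U = (\dim p).+2 by rewrite dim_U dim_p.
have := @concurrent_or_coplanar r r' x dim_x.
rewrite (pencil_cap rP r'P rr') (pencil_add dim_Up rP r'P rr').
move=> /(_ dim_p xr xr') /orP [px|xU].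
  by apply: meets_common px pt; rewrite -dimv_gt0 dim_p.
by apply: meets_of_dim xU tU _; rewrite dim_U dim_x dim_t dim_p.
Qed.

Section Transversals.
Variables m1 m2 : {vspace vT}.
Hypothesis skew : ~~ meets m1 m2.

Definition common_transversal t : bool :=
  [&& \dim t == 2, meets t m1 & meets t m2].

Lemma transversal_points t : common_transversal t ->
  [/\ \dim (t :&: m1) = 1%N, \dim (t :&: m2) = 1%N & t :&: m1 + t :&: m2 = t].
Proof.
case/and3P => /eqP dim_t t1 t2; apply: add_caps => //.
by rewrite /meets (meetsPn skew) capv0 eqxx.
Qed.

Lemma transversal_inj t t' : common_transversal t -> common_transversal t' ->
  t :&: m1 = t' :&: m1 -> t :&: m2 = t' :&: m2 -> t = t'.
Proof.
move=> /transversal_points [_ _ add_t] /transversal_points [_ _ add_t'].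
by move=> row column; rewrite -add_t row column.
Qed.

Lemma sub_add_distinct_points t t' m : \dim m = 2 ->
    \dim (t :&: m) = 1%N -> \dim (t' :&: m) = 1%N -> t :&: m != t' :&: m ->
  m <= t + t'.
Proof.
move=> dim_m dim_p dim_p' pp'.
rewrite -(add_points dim_m dim_p dim_p' (capvSr _ _) (capvSr _ _) pp').
by apply: addvS; apply: capvSl.
Qed.

(* Otherwise [m1] and [m2] would be skew lines of the plane [t + t']. *)
Lemma meeting_transversals t t' : \dim m1 = 2 -> \dim m2 = 2 ->
    common_transversal t -> common_transversal t' -> meets t t' ->
  t :&: m1 = t' :&: m1 \/ t :&: m2 = t' :&: m2.
Proof.
move=> dim_m1 dim_m2 tT t'T tt'.
have [->|row_neq] := eqVneq (t :&: m1) (t' :&: m1); first by left.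
have [->|column_neq] := eqVneq (t :&: m2) (t' :&: m2); first by right.
have [[t1 t2 _] [t'1 t'2 _]] := (transversal_points tT, transversal_points t'T).
case/negP: skew; apply: (@meets_of_dim _ _ (t + t')).
- exact: sub_add_distinct_points.
- exact: sub_add_distinct_points.
move: tt' tT t'T => + /and3P [/eqP dim_t _ _] /and3P [/eqP dim_t' _ _].
by have := dimv_sum_cap t t'; rewrite /meets -dimv_gt0; lia.
Qed.

Lemma transversal_misses_one t t' u : \dim m1 = 2 -> \dim m2 = 2 ->
    common_transversal t -> common_transversal t' -> common_transversal u ->
    t != t' -> t :&: m1 = t' :&: m1 -> u :&: m1 != t :&: m1 ->
  ~~ (meets t u && meets t' u).
Proof.
move=> dim_m1 dim_m2 tT t'T uT tt' row_tt' row_u; apply/negP => /andP [tu t'u].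
have same_column w : common_transversal w -> w :&: m1 = t :&: m1 ->
    meets w u -> w :&: m2 = u :&: m2.
  move=> wT row_w /(meeting_transversals dim_m1 dim_m2 wT uT) [row|//].
  by rewrite -row row_w eqxx in row_u.
case/eqP: tt'; apply: transversal_inj => //.
by rewrite (same_column t) // (same_column t').
Qed.

Lemma transversal_through p t : \dim m1 = 2 -> \dim m2 = 2 -> \dim p = 1%N ->
    ~~ (p <= m1) -> ~~ (p <= m2) -> common_transversal t -> p <= t ->
  t = (p + m1) :&: (p + m2).
Proof.
move=> dim_m1 dim_m2 dim_p pm1 pm2 /and3P [/eqP dim_t t1 t2] pt.
have t_sub m : ~~ (p <= m) -> meets t m -> t <= p + m.
  move=> pm tm; apply: line_sub_add => //.
    by rewrite meetsC meets_point.
  rewrite -meets_point // in pm.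
  by rewrite (meetsPn pm) /meets capv0 eqxx.
have dim_add m : \dim m = 2 -> ~~ (p <= m) -> \dim (p + m) = 3.
  move=> dim_m; rewrite -meets_point // => /meetsPn /dimv_disjoint_sum ->.
  by rewrite dim_p dim_m.
apply/eqP; rewrite eqEdim subv_cap !t_sub //= dim_t.
have := dimv_sum_cap (p + m1) (p + m2); rewrite !dim_add //.
have := dimvS (addvS (addvSr p m1) (addvSr p m2)).
by rewrite (dimv_disjoint_sum (meetsPn skew)); lia.
Qed.

End Transversals.

End Incidence.

Section CrossingFlags.
Variables (F : fieldType) (vT : vectType F).
Implicit Types (U p r s t x : {vspace vT}).
Local Open Scope vspace_scope.

Definition flag p U : Prop := [/\ \dim p = 1%N, \dim U = 3 & p <= U].

(* The pencils of the two flags then share exactly the line [p1 + p2]. *)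
Definition crossing p1 U1 p2 U2 : Prop :=
  [/\ flag p1 U1, flag p2 U2, p1 :&: p2 = 0 & U1 :&: U2 = p1 + p2].

Lemma crossingC p1 U1 p2 U2 : crossing p1 U1 p2 U2 -> crossing p2 U2 p1 U1.
Proof.
by case=> flag1 flag2 cap_p cap_U; split; rewrite // capvC // addvC.
Qed.

Lemma crossing_axis p1 U1 p2 U2 :
  crossing p1 U1 p2 U2 -> p1 + p2 \in pencil p1 U1.
Proof.
case=> [[dim_p1 _ _] [dim_p2 _ _] cap_p cap_U].
apply/pencilP; rewrite -cap_U capvSl cap_U addvSl.
by rewrite dimv_disjoint_sum ?dim_p1 ?dim_p2.
Qed.

Lemma crossing_skew p1 U1 p2 U2 r s : crossing p1 U1 p2 U2 ->
    r \in pencil p1 U1 -> s \in pencil p2 U2 ->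
    r != p1 + p2 -> s != p1 + p2 ->
  ~~ meets r s.
Proof.
move=> crossU rP sP rz sz; have zP1 := crossing_axis crossU.
have zP2 := crossing_axis (crossingC crossU); rewrite addvC in zP2.
case: crossU => _ _ cap_p cap_U; have cap_z : r :&: s <= p1 + p2.
  case/pencilP: rP sP => _ _ rU /pencilP [_ _ sU].
  by rewrite -cap_U; apply: capvS.
have cap_p1 : r :&: s <= p1 by rewrite -(pencil_cap rP zP1 rz) subv_cap capvSl.
have cap_p2 : r :&: s <= p2 by rewrite -(pencil_cap sP zP2 sz) subv_cap capvSr.
by apply/meetsPn/eqP; rewrite -subv0 -cap_p subv_cap cap_p1.
Qed.

Lemma crossing_meets p1 U1 p2 U2 x r r' s : crossing p1 U1 p2 U2 ->
    \dim x = 2 -> r \in pencil p1 U1 -> r' \in pencil p1 U1 -> r != r' ->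
    s \in pencil p2 U2 -> s != p1 + p2 ->
    meets x r -> meets x r' -> meets x s ->
  forall t, (t \in pencil p1 U1) || (t \in pencil p2 U2) -> meets x t.
Proof.
move=> crossU dim_x rP r'P rr' sP sz xr xr' xs.
have zP1 := crossing_axis crossU.
have zP2 := crossing_axis (crossingC crossU); rewrite addvC in zP2.
case: crossU => [[dim_p1 dim_U1 _] [dim_p2 dim_U2 _] _ _].
have meets1 t : t \in pencil p1 U1 -> meets x t.
  exact: pencil_meets dim_p1 dim_U1 dim_x rP r'P rr' xr xr'.
move=> t /orP [/meets1 //|].
exact: pencil_meets dim_p2 dim_U2 dim_x sP zP2 sz xs (meets1 _ zP1).
Qed.

Section Path.
Variables m1 m2 m3 : {vspace vT}.
Hypotheses (dim4 : \dim {: vT} = 4).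
Hypotheses (dim_m1 : \dim m1 = 2) (dim_m2 : \dim m2 = 2) (dim_m3 : \dim m3 = 2).
Hypotheses (skew12 : ~~ meets m1 m2) (m13 : m1 != m3) (meet13 : meets m1 m3).

Let dims_path : \dim (m1 :&: m3) = 1%N /\ \dim (m1 + m3) = 3.
Proof. exact: dim_meeting_lines. Qed.

Let cap_point_m2 : (m1 :&: m3) :&: m2 = 0.
Proof. by apply/eqP; rewrite -subv0 -(meetsPn skew12) capvS ?capvSl. Qed.

Let dim_cap_plane : \dim (m2 :&: (m1 + m3)) = 1%N.
Proof.
have [_ dim_U] := dims_path.
have dim_sum : (\dim (m2 + (m1 + m3)) <= 4)%N by rewrite -dim4 dimvS ?subvf.
suff : (\dim (m2 :&: (m1 + m3)) < 2)%N.
  by have := dimv_sum_cap m2 (m1 + m3); rewrite dim_U dim_m2; lia.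
rewrite -dim_m2 (ltn_leqif (dimv_leqif_sup (capvSl _ _))) subv_cap subvv /=.
apply: contra skew12 => m2U; apply: (meets_of_dim (addvSl _ _) m2U).
by rewrite dim_U dim_m1 dim_m2.
Qed.

Lemma path_crossing :
  crossing (m1 :&: m3) ((m1 :&: m3) + m2) (m2 :&: (m1 + m3)) (m1 + m3).
Proof.
have [dim_P dim_U] := dims_path; split.
- by split; rewrite ?addvSl // dimv_disjoint_sum // dim_P dim_m2.
- by split; rewrite ?capvSr.
- by apply/eqP; rewrite -subv0 -cap_point_m2 capvS ?capvSl.
by rewrite vspace_modl // (subv_trans (capvSl _ _)) ?addvSl.
Qed.

Lemma transversal_path_pencils t : \dim t = 2 ->
    meets t m1 -> meets t m2 -> meets t m3 ->
  (t \in pencil (m1 :&: m3) ((m1 :&: m3) + m2)) ||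
  (t \in pencil (m2 :&: (m1 + m3)) (m1 + m3)).
Proof.
have [dim_P dim_U] := dims_path; move=> dim_t t1 t2 t3.
have /orP [Pt|tU] := concurrent_or_coplanar dim_t dim_P t1 t3; apply/orP.
  left; apply/pencilP; rewrite dim_P; split=> //; apply: line_sub_add => //.
    by rewrite meetsC meets_point.
  by rewrite cap_point_m2 /meets capv0 eqxx.
right; apply/pencilP; rewrite dim_cap_plane; split=> //.
rewrite -meets_point // /meets capvC [m2 :&: _]capvC capvA.
by rewrite (capv_idPl tU).
Qed.

End Path.

End CrossingFlags.

Lemma card_finvect_vspace (F : finFieldType) (vT : vectType F)
    (U : {vspace vT}) :
  #|[set v : finvect_type vT | v \in U]| = #|F| ^ \dim U.
Proof.
(* [card_vspace] is stated for vector structures on a finite carrier. *)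
case: vT U => T cT U; rewrite cardsE.
exact: (@card_vspace F (Finite.clone (finvect_type (Vector.Pack cT)) _) cT U).
Qed.

Section Counting.
Variables (F : finFieldType) (vT : vectType F).
Implicit Types (U p t : {vspace vT}).
Local Notation q := #|F|.
Local Open Scope vspace_scope.

Lemma card_vspaceD p U : p <= U ->
  #|[set v : finvect_type vT | (v \in U) && (v \notin p)]| =
    (q ^ \dim U - q ^ \dim p)%N.
Proof.
move=> pU; rewrite -!card_finvect_vspace -cardsDS.
  by apply: eq_card => v; rewrite !inE andbC.
by apply/subsetP => v; rewrite !inE; apply: (subvP pU).
Qed.

Lemma adjoin_vector_pencil p U (v : vT) :
  p <= U -> v \in U -> v \notin p -> p + <[v]> \in pencil p U.
Proof.
move=> pU vU vp; have v0 : v != 0%R by apply: contraNneq vp => ->; apply: mem0v.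
apply/pencilP; split; rewrite ?addvSl ?subv_add ?pU -?memvE //.
rewrite dimv_disjoint_sum ?dim_vline ?v0 ?addn1 //.
by apply/meetsPn; rewrite meetsC meets_point ?dim_vline ?v0 // -memvE.
Qed.

Lemma card_pencil_mul p U : p <= U ->
  (#|pencil p U| * (q ^ (\dim p).+1 - q ^ \dim p) = q ^ \dim U - q ^ \dim p)%N.
Proof.
move=> pU; rewrite -card_vspaceD // -[RHS]sum1_card.
rewrite (partition_big (fun v : vT => p + <[v]>) [in pencil p U]) => [|v];
  last by rewrite inE => /andP [vU vp]; apply: adjoin_vector_pencil.
rewrite -sum_nat_const; apply: eq_bigr => t /pencilP [dim_t pt tU].
rewrite -dim_t -card_vspaceD // -sum1_card; apply: eq_bigl => v; rewrite !inE.
apply/andP/andP => [[vt vp]|[/andP [vU vp] /eqP <-]]; last first.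
  by split=> //; apply: (subvP (addvSr _ _)); apply: memv_line.
have /pencilP [dim_pv _ pv_t] := adjoin_vector_pencil pt vt vp.
by rewrite (subvP tU) // vp eqEdim pv_t dim_t dim_pv leqnn.
Qed.

Lemma card_pencil p U k : p <= U -> \dim U = (\dim p + k)%N ->
  #|pencil p U| = (\sum_(i < k) q ^ i)%N.
Proof.
move=> pU dim_U; have q_gt1 : (1 < q)%N := finNzRing_gt1 F.
have geometric d j :
    (q ^ (d + j) - q ^ d = (\sum_(i < j) q ^ i) * (q.-1 * q ^ d))%N.
  by rewrite expnD -{2}[(q ^ d)%N]muln1 -mulnBr subn1 predn_exp; ring.
have := card_pencil_mul pU; rewrite dim_U -addn1 !geometric big_ord1 mul1n.
move/eqP; rewrite eqn_pmul2r => [/eqP //|].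
by rewrite muln_gt0 expn_gt0; lia.
Qed.

Lemma card_pencil2 p U : p <= U -> \dim U = (\dim p).+2 -> #|pencil p U| = q.+1.
Proof.
move=> pU dim_U; rewrite (card_pencil (k := 2) pU) ?addn2 //.
by rewrite !big_ord_recr big_ord0 /= expn1.
Qed.

Lemma card_pencil3 p U :
  p <= U -> \dim U = (\dim p).+3 -> #|pencil p U| = (q ^ 2 + q + 1)%N.
Proof.
move=> pU dim_U; rewrite (card_pencil (k := 3) pU) ?addn3 //.
by rewrite !big_ord_recr big_ord0 /=; ring.
Qed.

Lemma card_lines_plane U : \dim U = 3 ->
  #|[pred t : {vspace vT} | (\dim t == 2) && (t <= U)]| = (q ^ 2 + q + 1)%N.
Proof.
move=> dim_U; apply/eqP; rewrite -(eqn_pmul2r (ltn0Sn q)); apply/eqP.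
rewrite -(@card_pencil3 0 U) ?sub0v ?dimv0 // -!sum_nat_const.
have points_of t : \dim t = 2 ->
    q.+1 = (\sum_(p : {vspace vT} | (p <= t)%VS && (\dim p == 1)) 1)%N.
  move=> dim_t; rewrite sum1_card -(@card_pencil2 0 t) ?sub0v ?dimv0 //.
  by apply: eq_card => p; rewrite !inE dimv0 sub0v andbC.
rewrite (eq_bigr _ (fun t tU => points_of t (eqP (andP tU).1))).
rewrite (exchange_big_dep [in pencil 0 U]) /=; last first.
  move=> t p /andP [_ tU] /andP [pt dim_p].
  by rewrite !inE dimv0 sub0v dim_p (subv_trans pt).
apply: eq_bigr => p /pencilP []; rewrite dimv0 => dim_p _ pU.
rewrite -(card_pencil2 pU) ?dim_p // -sum1_card; apply: eq_bigl => t.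
by rewrite !inE dim_p eqxx andbT -andbA [(t <= U) && _]andbC.
Qed.

End Counting.

(** * The graph of lines of PG(3,q) *)

Section Lines.
Variable F : finFieldType.
Local Notation q := #|F|.
Local Notation G := (qkneser421 F).
Local Notation V4 := 'rV[F]_4.
Implicit Types (t l m z : G) (A B I S : {set G}) (p U : {vspace V4}).

Lemma dim_rV4 : \dim {: V4} = 4.
Proof. by rewrite dimvf dim_matrix. Qed.

Lemma dim_line t : \dim (val t) = 2.
Proof. exact: eqP (valP t). Qed.

Lemma line_eqE t l : (val t == val l) = (t == l).
Proof. by apply/eqP/eqP => [/val_inj|->]. Qed.

Lemma adjacentE t l : sedge t l = ~~ meets (val t) (val l).
Proof. by rewrite negbK. Qed.

Lemma nonadjacentE t l : ~~ sedge t l = meets (val t) (val l).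
Proof. by []. Qed.

Definition lines p U : {set G} := [set t : G | val t \in pencil p U].

Lemma card_vertices (P : pred {vspace V4}) :
  #|[set t : G | P (val t)]| = #|[pred U | (\dim U == 2) && P U]|.
Proof.
rewrite -(card_imset _ val_inj); apply: eq_card => U; rewrite [RHS]inE.
apply/imsetP/andP => [[t + ->]|[dim_U PU]].
  by rewrite inE dim_line => ->.
by exists (exist _ U dim_U : G); rewrite ?inE.
Qed.

Lemma card_lines p U : \dim p = 1 -> #|lines p U| = #|pencil p U|.
Proof.
move=> dim_p; rewrite (card_vertices (pencil p U)); apply: eq_card => t.
by rewrite inE [RHS]inE /pencil /= dim_p; case: eqP.
Qed.

Lemma card_concurrent_lines p : \dim p = 1 -> #|lines p fullv| = q ^ 2 + q + 1.
Proof.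
by move=> dim_p; rewrite card_lines // card_pencil3 ?subvf // dim_rV4 dim_p.
Qed.

Lemma card_flag_lines p U : flag p U -> #|lines p U| = q.+1.
Proof.
by case=> dim_p dim_U pU; rewrite card_lines // card_pencil2 // dim_U dim_p.
Qed.

Lemma card_independent_lines I :
  {in I &, forall t l, ~~ sedge t l} -> #|I| <= q ^ 2 + q + 1.
Proof.
move=> indI; have [|] := leqP #|I| 1; first by lia.
case/card_gt1P => l1 [l2 [l1I l2I l12]].
have [dim_P dim_U] := dim_meeting_lines (dim_line l1) (dim_line l2) l12
  (indI _ _ l1I l2I).
have [/forall_inP through_P|] :=
    boolP [forall t in I, val l1 :&: val l2 <= val t]%VS.
  rewrite -(card_concurrent_lines dim_P).
  apply: subset_leq_card; apply/subsetP => t tI.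
  by rewrite inE; apply/pencilP; rewrite dim_P dim_line through_P ?subvf.
rewrite negb_forall => /existsP [l3]; rewrite negb_imply => /andP [l3I P_l3].
have [l31 l32] := (indI l3 l1 l3I l1I, indI l3 l2 l3I l2I).
rewrite -(card_lines_plane dim_U) -card_vertices.
apply: subset_leq_card; apply/subsetP => t tI; rewrite inE.
by apply: (coplanar_triangle dim_P (dim_line l3) P_l3 l31 l32 (dim_line t));
  apply: indI.
Qed.

Lemma leq_card_points (m : {vspace V4}) S : \dim m = 2 ->
    {in S, forall t, \dim (val t :&: m) = 1} ->
    {in S &, injective (fun t => val t :&: m)%VS} ->
  #|S| <= q.+1.
Proof.
move=> dim_m point_t inj_t; rewrite -(card_in_imset inj_t).
rewrite -(@card_pencil2 _ _ 0%VS m) ?sub0v ?dimv0 //.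
apply: subset_leq_card; apply/subsetP => p /imsetP [t tS ->].
by apply/pencilP; rewrite point_t // dimv0 sub0v capvSr.
Qed.

Definition neighbours A t : {set G} := [set u in A | sedge t u].

(* If two transversals of the family meet [m1] in the same point, any other one
   meets [m1] in this point or is adjacent to one of the two. *)
Lemma card_transversal_matching m1 m2 B : sedge m1 m2 ->
    {in B, forall t, common_transversal (val m1) (val m2) (val t)} ->
    {in B, forall t, #|neighbours B t| <= 1} ->
  #|B| <= q + 3.
Proof.
rewrite adjacentE => skew transB degB; pose row t := (val t :&: val m1)%VS.
have points t (tB : t \in B) := transversal_points skew (transB t tB).
have [/dinjectiveP row_inj|] := boolP (dinjectiveb row (mem B)).
  have q_le : q.+1 <= q + 3 by rewrite -addn1 leq_add2l.
  apply: leq_trans (leq_card_points (dim_line m1) _ row_inj) q_le.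
  by move=> t /points [].
case/dinjectivePn => t tB [t' /andP [/= t't t'B] row_tt'].
have card_row : #|[set u in B | row u == row t]| <= q.+1.
  apply: (leq_card_points (dim_line m2)) => [u|u w]; rewrite !inE.
    by case/andP => /points [].
  move=> /andP [uB /eqP row_u] /andP [wB /eqP row_w] col; apply: val_inj.
  by apply: (transversal_inj skew) col; rewrite ?transB // -/(row u) row_u.
have coverB : B \subset
    [set u in B | row u == row t] :|: (neighbours B t :|: neighbours B t').
  apply/subsetP => u uB; rewrite !in_setU !in_set uB !andTb.
  case: eqVneq => // row_u; rewrite orFb !adjacentE -negb_and.
  by apply: (transversal_misses_one skew (dim_line m1) (dim_line m2));
    rewrite ?transB // line_eqE eq_sym.
apply: leq_trans (subset_leq_card coverB) (leq_trans (leq_card_setU _ _) _).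
rewrite -[(q + 3)%N]addSnnS leq_add //; apply: leq_trans (leq_card_setU _ _) _.
by rewrite (@leq_add _ _ 1 1) ?degB.
Qed.

Lemma card_induced_matching A :
  {in A, forall t, #|neighbours A t| <= 1} -> #|A| <= q ^ 2 + q + 1.
Proof.
move=> degA; have q_gt1 : 1 < q := finNzRing_gt1 F.
have [|no_edge] := boolP [exists m1 in A, exists m2 in A, sedge m1 m2];
  last first.
  apply: card_independent_lines => t l tA lA; apply: contra no_edge => etl.
  by apply/exists_inP; exists t => //; apply/exists_inP; exists l.
case/exists_inP => m1 m1A /exists_inP [m2 m2A e12].
have unique_neighbour t u w : t \in A -> u \in A -> w \in A ->
    sedge t u -> sedge t w -> u = w.
  move=> tA uA wA etu etw.
  by apply: (card_le1_eqP (degA t tA)); rewrite inE ?uA ?wA.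
pose B := A :\: [set m1; m2].
have cardB : #|B| <= q + 3.
  apply: (card_transversal_matching e12) => t; rewrite !inE negb_or;
    case/andP => /andP [t1 t2] tA.
    rewrite /common_transversal dim_line /= -!nonadjacentE; apply/andP; split.
      apply: contra t2 => et1.
      by rewrite (unique_neighbour m1 t m2) // sedge_sym.
    apply: contra t1 => et2.
    by rewrite (unique_neighbour m2 t m1) // sedge_sym.
  apply: leq_trans (degA t tA); apply: subset_leq_card; apply/subsetP => u.
  by rewrite !inE => /andP [/andP [_ ->]].
have cardA : #|A| <= #|B| + 2.
  rewrite -(cardsID [set m1; m2] A) addnC leq_add2l.
  apply: leq_trans (subset_leq_card (subsetIr _ _)) _.
  by rewrite cards2; case: eqP.
by nia.
Qed.

Lemma in_perp_triple m1 m2 m3 t : (t \in perp [set m1; m2; m3]) =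
  [&& meets (val t) (val m1), meets (val t) (val m2) & meets (val t) (val m3)].
Proof.
apply/perpP/and3P => [perp_t|[t1 t2 t3] m].
  by split; rewrite -nonadjacentE sedge_sym; apply: perp_t;
    rewrite !inE eqxx ?orbT.
by rewrite !inE -orbA => /or3P [] /eqP ->; rewrite sedge_sym.
Qed.

(* A transversal is determined by its point on [m2]. *)
Lemma card_perp_triangle m1 m2 m3 :
    sedge m1 m2 -> sedge m2 m3 -> sedge m1 m3 ->
  #|perp [set m1; m2; m3]| <= q.+1.
Proof.
move=> e12 e23 e13; rewrite adjacentE in e13.
have trans13 t : t \in perp [set m1; m2; m3] ->
    common_transversal (val m1) (val m3) (val t).
  by rewrite in_perp_triple /common_transversal dim_line => /and3P [-> _ ->].
have point2 t : t \in perp [set m1; m2; m3] -> \dim (val t :&: val m2) = 1.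
  rewrite in_perp_triple adjacentE in e12 * => /and3P [t1 t2 _].
  have [|_ -> //] := transversal_points e12 (t := val t).
  by rewrite /common_transversal dim_line t1 t2.
apply: (leq_card_points (dim_line m2) point2) => t u tM uM cap_tu.
have p_notin (w : G) : sedge m2 w -> ~~ (val t :&: val m2 <= val w)%VS.
  rewrite adjacentE -meets_point ?point2 //; apply: contra.
  by apply: meetsS; rewrite ?capvSr.
rewrite sedge_sym in e12.
have through := transversal_through e13 (dim_line m1) (dim_line m3)
  (point2 t tM) (p_notin m1 e12) (p_notin m3 e23).
apply: val_inj; rewrite (through (val t)) ?trans13 ?capvSl //.
by rewrite -(through (val u)) ?trans13 // cap_tu capvSl.
Qed.

Section Crossing.
Variables (p1 U1 p2 U2 : {vspace V4}) (z : G).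
Hypotheses (crossU : crossing p1 U1 p2 U2) (zE : val z = (p1 + p2)%VS).

Lemma card_lines_but_axis : #|lines p1 U1 :\ z| = q.
Proof.
have [flag1 _ _ _] := crossU; have := card_flag_lines flag1.
by rewrite (cardsD1 z) inE zE (crossing_axis crossU) => -[].
Qed.

Lemma perp_lines_hub B :
    1 < #|B :&: (lines p1 U1 :\ z)| -> 0 < #|B :&: (lines p2 U2 :\ z)| ->
  exists T : {set G}, [/\ T \subset B, induces_connected T &
    perp T \subset perp (lines p1 U1 :|: lines p2 U2)].
Proof.
case/card_gt1P => r [r' [/setIP [rB rP] /setIP [r'B r'P] rr']].
case/card_gt0P => s /setIP [sB sP].
move: rP r'P sP; rewrite !inE => /andP [rz rP] /andP [r'z r'P] /andP [sz sP].
have skew w : w != z -> val w \in pencil p1 U1 -> sedge s w.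
  move=> wz wP; rewrite sedge_sym adjacentE.
  by apply: (crossing_skew crossU wP sP); rewrite -zE line_eqE.
exists [set s; r; r']; split.
- by rewrite !subUset !sub1set sB rB.
- apply: (@induces_connected_hub _ _ s) => [|w]; first by rewrite !inE eqxx.
  by rewrite !inE -orbA => /or3P [] /eqP ->; [rewrite eqxx | rewrite skew ..].
apply/subsetP => x; rewrite in_perp_triple => /and3P [xs xr xr'].
have rr'_val : val r != val r' by rewrite line_eqE.
have sz_val : val s != (p1 + p2)%VS by rewrite -zE line_eqE.
apply/perpP => t; rewrite in_setU !in_set sedge_sym nonadjacentE.
exact: (crossing_meets crossU (dim_line x) rP r'P rr'_val sP sz_val xr xr' xs).
Qed.

End Crossing.

Section CrossingPerp.
Variables (p1 U1 p2 U2 : {vspace V4}) (M : {set G}).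
Hypothesis crossU : crossing p1 U1 p2 U2.
Hypothesis perpM : perp M \subset lines p1 U1 :|: lines p2 U2.

Lemma axis_line : exists z : G, val z = (p1 + p2)%VS.
Proof.
have /pencilP [dim_z _ _] := crossing_axis crossU.
have [[dim_p1 _ _] _ _ _] := crossU; rewrite dim_p1 in dim_z.
by exists (exist _ (p1 + p2)%VS (introT eqP dim_z) : G).
Qed.

Lemma axis_perp z :
  val z = (p1 + p2)%VS -> z \in perp (lines p1 U1 :|: lines p2 U2).
Proof.
move=> zE; have [[dim_p1 _ _] [dim_p2 _ _] _ _] := crossU.
apply/perpP => t; rewrite !inE nonadjacentE zE.
case/orP => /and3P [_ pt _].
  by apply: meets_common pt (addvSl _ _); rewrite -dimv_gt0 dim_p1.
by apply: meets_common pt (addvSr _ _); rewrite -dimv_gt0 dim_p2.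
Qed.

Lemma card_perp_crossing : #|perp M :\: perp (perp M)| <= 2 * q.
Proof.
have [z zE] := axis_line.
have zE_sym : val z = (p2 + p1)%VS by rewrite zE addvC.
rewrite mul2n -addnn -{1}(card_lines_but_axis crossU zE).
rewrite -(card_lines_but_axis (crossingC crossU) zE_sym).
apply: leq_trans (leq_card_setU _ _); apply: subset_leq_card.
apply/subsetP => t /setDP [tM t_perp2].
rewrite -setDUl in_setD1 (subsetP perpM) // andbT.
apply: contraNneq t_perp2 => ->.
by apply: (subsetP (perpS perpM)); apply: axis_perp.
Qed.

Lemma perp_crossing_closed B : B \subset perp M -> q.+1 < #|B| ->
  exists T : {set G}, [/\ T \subset B, induces_connected T &
    perp T \subset perp (perp M)].
Proof.
move=> BM cardB; have q_gt1 : 1 < q := finNzRing_gt1 F.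
have [z zE] := axis_line.
pose B1 := B :&: (lines p1 U1 :\ z); pose B2 := B :&: (lines p2 U2 :\ z).
have coverB : B \subset z |: (B1 :|: B2).
  apply/subsetP => t tB; rewrite in_setU1 -setIUr -setDUl in_setI in_setD1 tB.
  by rewrite (subsetP perpM) ?(subsetP BM) // andbT orbN.
have cardB12 : q < #|B1| + #|B2|.
  rewrite -ltnS; apply: leq_trans cardB (leq_trans (subset_leq_card coverB) _).
  by rewrite cardsU1 -add1n leq_add ?leq_b1 ?leq_card_setU.
have zE_sym : val z = (p2 + p1)%VS by rewrite zE addvC.
have cardB1 : #|B1| <= q.
  by rewrite -(card_lines_but_axis crossU zE) subset_leq_card ?subsetIr.
have cardB2 : #|B2| <= q.
  rewrite -(card_lines_but_axis (crossingC crossU) zE_sym).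
  by rewrite subset_leq_card ?subsetIr.
suff [T [TB conT perpT]] : exists T : {set G},
    [/\ T \subset B, induces_connected T &
        perp T \subset perp (lines p1 U1 :|: lines p2 U2)].
  by exists T; split=> //; apply: subset_trans perpT (perpS perpM).
have [B1_gt1|B1_le1] := ltnP 1 #|B1|.
  by apply: (perp_lines_hub crossU zE B1_gt1); rewrite -/B2; lia.
rewrite setUC.
by apply: (perp_lines_hub (crossingC crossU) zE_sym); rewrite -/B1 -/B2; lia.
Qed.

End CrossingPerp.

Lemma perp_path_crossing m1 m2 m3 : sedge m1 m2 -> m1 != m3 -> ~~ sedge m1 m3 ->
  exists p1 U1 p2 U2, crossing p1 U1 p2 U2 /\
    perp [set m1; m2; m3] \subset lines p1 U1 :|: lines p2 U2.
Proof.
rewrite adjacentE -line_eqE => skew12 m13 ne13.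
have crossU := path_crossing dim_rV4 (dim_line m1) (dim_line m2)
  (dim_line m3) skew12 m13 ne13.
do 4!eexists; split; first exact: crossU.
apply/subsetP => t; rewrite in_perp_triple in_setU !in_set => /and3P [t1 t2 t3].
exact: (transversal_path_pencils dim_rV4 (dim_line m1) (dim_line m2)
  (dim_line m3) skew12 m13 ne13 (dim_line t)).
Qed.

Lemma connected_dominant_exists A : q ^ 2 + q + 1 < #|A| ->
  exists2 C : {set G}, C \subset A & induces_connected C /\ dominant C.
Proof.
move=> cardA; have q_gt1 : 1 < q := finNzRing_gt1 F.
have [no_path|] := boolP [forall m2 in A, #|neighbours A m2| <= 1].
  by have := card_induced_matching (forall_inP no_path); rewrite leqNgt cardA.
rewrite negb_forall => /existsP [m2]; rewrite negb_imply -ltnNge => /andP [m2A].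
case/card_gt1P => m1 [m3 []]; rewrite !inE.
move=> /andP [m1A e21] /andP [m3A e23] m13.
have conM : induces_connected [set m1; m2; m3].
  apply: (@induces_connected_hub _ _ m2) => [|m]; rewrite !inE.
    by rewrite eqxx orbT.
  by rewrite -orbA => /or3P [] /eqP -> //; rewrite eqxx.
have MA : [set m1; m2; m3] \subset A by rewrite !subUset !sub1set m1A m2A.
have cardM : 1 < #|[set m1; m2; m3]|.
  by apply/card_gt1P; exists m1, m3; rewrite !inE !eqxx ?orbT.
have e12 : sedge m1 m2 by rewrite sedge_sym.
have bound : 2 * q + q.+1 < #|A|.
  by apply: leq_ltn_trans cardA; rewrite -[q.+1]addn1 addnA !leq_add2r leq_mul.
have dominant_from_M :=
  @dominant_connected_subset _ _ _ (2 * q) q.+1 MA conM cardM.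
have [e13|ne13] := boolP (sedge m1 m3).
  have card_perp := card_perp_triangle e12 e23 e13.
  apply: dominant_from_M => //.
    apply: leq_trans (subset_leq_card (subsetDl _ _)) (leq_trans card_perp _).
    by rewrite mul2n -addnn -add1n leq_add2r ltnW.
  move=> B BM; rewrite ltnNge.
  by rewrite (leq_trans (subset_leq_card BM) card_perp).
have [p1 [U1 [p2 [U2 [crossU perpM]]]]] := perp_path_crossing e12 m13 ne13.
apply: dominant_from_M => //.
  exact: card_perp_crossing crossU perpM.
by move=> B; apply: (perp_crossing_closed crossU perpM).
Qed.

Lemma concurrent_lines_independent p :
  \dim p = 1 -> {in lines p fullv &, forall t l, ~~ sedge t l}.
Proof.
move=> dim_p t l; rewrite !inE nonadjacentE => /and3P [_ pt _] /and3P [_ pl _].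
by apply: meets_common pt pl; rewrite -dimv_gt0 dim_p.
Qed.

Lemma concurrent_lines_non_neighbour p : \dim p = 1 ->
  {in lines p fullv, forall v,
    exists2 u, u \notin lines p fullv & ~~ sedge v u}.
Proof.
move=> dim_p v; rewrite inE => /and3P [_ pv _].
have q_gt1 : 1 < q := finNzRing_gt1 F.
have [p' /pencilP []] : exists2 p', p' \in pencil 0%VS (val v) & p' != p.
  by apply: exists_neq_in; rewrite card_pencil2 ?sub0v ?dimv0 ?dim_line // ltnW.
rewrite dimv0 => dim_p' _ p'v p'p.
have [u] : exists2 u, u \in lines p' fullv & u != v.
  by apply: exists_neq_in; rewrite card_concurrent_lines //; nia.
rewrite inE => /and3P [_ p'u _] uv; exists u; last first.
  rewrite nonadjacentE; apply: meets_common p'v p'u.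
  by rewrite -dimv_gt0 dim_p'.
apply: contra uv; rewrite inE -line_eqE => /and3P [_ pu _].
by rewrite -(add_points (dim_line u) dim_p' dim_p p'u pu p'p)
   (add_points (dim_line v) dim_p' dim_p p'v pv p'p).
Qed.

End Lines.

Theorem theorem1p6 (q : nat) (hq : prime_power q)
    (F : finFieldType) (hF : #|F| = q) :
  is_treewidth (qkneser421 F)
    (#|qkneser421 F|%:Z - (q ^ 2 + q + 2)%N%:Z)%R.
Proof.
subst q; set q := #|F|; pose p : {vspace 'rV[F]_4} := <[vpick {: 'rV[F]_4}]>%VS.
have dim_p : \dim p = 1 by rewrite dim_vline vpick0 -dimv_eq0 dim_rV4.
have card_V : #|qkneser421 F| = q ^ 2 + q + 1 + #|~: lines p fullv|.
  by rewrite -(card_concurrent_lines dim_p) cardsC.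
have -> : (#|qkneser421 F|%:Z - (q ^ 2 + q + 2)%N%:Z =
    #|~: lines p fullv|%:Z - 1)%R.
  by rewrite card_V; lia.
apply: is_treewidth_max_bag.
  exact: max_star_bag (concurrent_lines_independent dim_p)
    (concurrent_lines_non_neighbour dim_p).
move=> D; have -> : #|~: lines p fullv| = #|qkneser421 F| - (q ^ 2 + q + 1).
  by rewrite card_V addKn.
apply: (bramble_max_bag (P := fun C => induces_connected C /\ dominant C)).
- by move=> C [].
- by move=> B C [_ domB] [_ domC]; apply: dominant_touching.
exact: connected_dominant_exists.
Qed.
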